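(* Let $A\in\mathbb{R}^{n\times n}$ be invertible and symmetric, $X_k\in\mathbb{R}^{n\times n}$ symmetric, $B\in\mathbb{R}^{n\times n}$ symmetric positive definite, and $S\in\mathbb{R}^{n\times q}$. Then the problems $$X_{k+1}=\arg\min_{X\in\mathbb{R}^{n\times n}}\tfrac12\|X-X_k\|_{F(B)}^2\quad\text{subject to}\quad S^\top AX=S^\top,\quad X=X^\top$$ and $$X_{k+1}=\arg_X\min_{X\in\mathbb{R}^{n\times n},\,Y\in\mathbb{R}^{n\times q}}\tfrac12\|X-A^{-1}\|_{F(B)}^2\quad\text{subject to}\quad X=X_k+\tfrac12\left(YS^\top AB^{-1}+B^{-1}A^\top SY^\top\right)$$ are equivalent, i.e. they define the same $X_{k+1}$. Furthermore, if $S$ has full column rank, then with $\Lambda=(S^\top AB^{-1}AS)^{-1}$ the explicit solution of both is $$X_{k+1}=X_k-(X_kAS-S)\Lambda S^\top AB^{-1}+B^{-1}AS\Lambda(S^\top AX_k-S^\top)\left(AS\Lambda S^\top AB^{-1}-I\right).$$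
   Context: $\|X\|_{F(B)}^2=\mathrm{Tr}(X^\top BXB)=\|B^{1/2}XB^{1/2}\|_F^2$ is the weighted Frobenius norm. $\arg_X\min_{X,Y}$ means the $X$-component of a minimizer $(X,Y)$. *)

(* Defs.v *)
From HB Require Import structures.
From mathcomp Require Import all_boot all_order all_algebra.
From mathcomp Require Import classical_sets reals.

Set Implicit Arguments.
Unset Strict Implicit.
Unset Printing Implicit Defensive.

Import Order.TTheory GRing.Theory Num.Theory.
Local Open Scope classical_set_scope.
Local Open Scope ring_scope.

Definition symmetric_mx (R : realType) (n : nat) (M : 'M[R]_n) : Prop :=
  M = M^T.

Definition spd_mx (R : realType) (n : nat) (B : 'M[R]_n) : Prop :=
  symmetric_mx B /\
  forall x : 'cV[R]_n, x != 0 -> 0 < (x^T *m B *m x) 0 0.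

(* The square of the weighted Frobenius norm; for symmetric positive definite
   B it is the squared Frobenius norm of B^(1/2) X B^(1/2). *)
Definition sqnormFB (R : realType) (n : nat) (B X : 'M[R]_n) : R :=
  \tr (X^T *m B *m X *m B).

(* The set of all global minimizers of f over D (possibly empty). *)
Definition argmin (R : realType) (T : Type) (D : set T) (f : T -> R) : set T :=
  [set x | D x /\ forall y, D y -> f x <= f y].

Section Problems.
Variables (R : realType) (n q : nat) (A B Xk : 'M[R]_n) (S : 'M[R]_(n, q)).

Definition sketch_and_project : set 'M[R]_n :=
  argmin [set X | S^T *m A *m X = S^T /\ X = X^T]
         (fun X => 2^-1 * sqnormFB B (X - Xk)).

Definition constrain_and_approximate : set 'M[R]_n :=
  fst @` argmin
    [set XY : 'M[R]_n * 'M[R]_(n, q) |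
      XY.1 = Xk + 2^-1 *: (XY.2 *m S^T *m A *m invmx B
                           + invmx B *m A^T *m S *m XY.2^T)]
    (fun XY => 2^-1 * sqnormFB B (XY.1 - invmx A)).

Definition sketched_gram : 'M[R]_q := S^T *m A *m invmx B *m A *m S.

Definition explicit_update : 'M[R]_n :=
  let L := invmx sketched_gram in
  Xk - (Xk *m A *m S - S) *m L *m S^T *m A *m invmx B
     + invmx B *m A *m S *m L *m (S^T *m A *m Xk - S^T)
       *m (A *m S *m L *m S^T *m A *m invmx B - 1%:M).

End Problems.

(* Main.v *)
Require Import Defs.
From HB Require Import structures.
From mathcomp Require Import all_boot all_order all_algebra.
From mathcomp Require Import classical_sets reals.

Set Implicit Arguments.
Unset Strict Implicit.
Unset Printing Implicit Defensive.

Import Order.TTheory GRing.Theory Num.Theory.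
Local Open Scope classical_set_scope.
Local Open Scope ring_scope.

(* Write [W = B^-1], [C = A S] and give matrices the inner product
   [<U, V> = tr (U^T B V B)], which is positive definite because [B = L L^T]
   makes [<X, X>] the squared Frobenius norm of [L^T X L].  Every matrix
   [Y C^T W + W C Y^T] is orthogonal to every symmetric [Z] with [C^T Z = 0].
   So a point [X1] that is feasible for both problems solves both, uniquely:
   the Pythagorean identity holds for [X - Xk = (X - X1) + (X1 - Xk)] in the
   first and for [X - A^-1 = (X - X1) + (X1 - A^-1)] in the second.  When [S]
   has full column rank the explicit formula is such a point; in general, [S]
   may be replaced by a basis of its column space. *)

Lemma spd_mx_unit (R : realType) (n : nat) (B : 'M[R]_n) :
  spd_mx B -> B \in unitmx.
Proof.
move=> [_ Bpos]; rewrite -row_free_unit; apply: inj_row_free => v vB0.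
apply/eqP; apply: contraT => v_neq0.
have := Bpos v^T; rewrite trmx_eq0 => /(_ v_neq0).
by rewrite trmxK vB0 mul0mx mxE ltxx.
Qed.

(** Serves twice: for the Schur complement in [cholesky] and for the matrix to be inverted in the
    explicit formula. *)
Lemma spd_mx_congr (R : realType) (n m : nat) (B : 'M[R]_n)
    (M : 'M[R]_(n, m)) :
  spd_mx B -> (forall x : 'cV_m, M *m x = 0 -> x = 0) ->
  spd_mx (M^T *m B *m M).
Proof.
move=> [Bsym Bpos] Minj; split.
  by rewrite /symmetric_mx !trmx_mul trmxK -Bsym mulmxA.
move=> x x_neq0; have Mx_neq0 : M *m x != 0.
  by apply: contra_neq x_neq0; exact: Minj.
by have := Bpos _ Mx_neq0; rewrite trmx_mul !mulmxA.
Qed.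

(** Induction on the size: once the first row and column are eliminated with the pivot [b > 0], the
    Schur complement [D - b^-1 c c^T] is again positive definite, and its factor is the lower right
    block of the new one. *)
Lemma cholesky (R : realType) (n : nat) (B : 'M[R]_n) :
  spd_mx B -> exists L : 'M[R]_n, B = L *m L^T.
Proof.
elim: n B => [|n IHn] B.
  by exists 0; apply/matrixP => -[].
rewrite -[n.+1]/(1 + n)%N in B *.
move=> Bspd; have [Bsym Bpos] := Bspd.
set b := B 0 0; set c := dlsubmx B; set D := drsubmx B.
have BE : B = block_mx b%:M c^T c D.
  rewrite -[LHS]submxK; congr block_mx.
    by rewrite [LHS]mx11_scalar !mxE; congr (B _ _)%:M; apply/val_inj.
  by rewrite /c {2}Bsym trmx_dlsub trmxK.
have b_gt0 : 0 < b.
  have := Bpos (delta_mx 0 0); rewrite trmx_delta -rowE -colE !mxE; apply.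
  by apply/eqP => /matrixP/(_ 0 0)/eqP; rewrite !mxE !eqxx oner_eq0.
have b_neq0 : b != 0 by rewrite gt_eqF.
(* The columns of [M] are [B]-orthogonal to the first basis vector: the top row of [B *m M]
   vanishes, so [M^T *m B *m M] is the Schur complement. *)
pose M : 'M[R]_(1 + n, n) := col_mx (- b^-1 *: c^T) 1%:M.
have schurE : M^T *m B *m M = D - b^-1 *: (c *m c^T).
  rewrite BE -mulmxA mul_block_col tr_col_mx mul_row_col.
  rewrite !mulmx1 mul_scalar_mx scalerA mulrN mulfV // scaleN1r addNr mulmx0.
  by rewrite add0r trmx1 mul1mx -scalemxAr scaleNr addrC.
have [L' L'E] : exists L' : 'M[R]_n, D - b^-1 *: (c *m c^T) = L' *m L'^T.
  apply: IHn; rewrite -schurE; apply: spd_mx_congr => // x.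
  rewrite mul_col_mx mul1mx => /(congr1 dsubmx).
  by rewrite col_mxKd linear0.
exists (block_mx (Num.sqrt b)%:M 0 ((Num.sqrt b)^-1 *: c) L').
have sb2 : Num.sqrt b * Num.sqrt b = b by rewrite -expr2 sqr_sqrtr ?ltW.
have sb_neq0 : Num.sqrt b != 0 by rewrite gt_eqF ?sqrtr_gt0.
rewrite BE tr_block_mx mulmx_block !trmx0 !mulmx0 !mul0mx !addr0.
rewrite tr_scalar_mx -scalar_mxM sb2 linearZ /= mul_scalar_mx mul_mx_scalar.
rewrite !scalerA divff // !scale1r -scalemxAl -scalemxAr scalerA -invfM sb2.
by rewrite -L'E addrC subrK.
Qed.

Lemma mxtrace_gram (R : realType) (m n : nat) (Z : 'M[R]_(m, n)) :
  \tr (Z^T *m Z) = \sum_i \sum_j Z j i ^+ 2.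
Proof.
by apply: eq_bigr => i _; rewrite mxE; apply: eq_bigr => j _; rewrite mxE expr2.
Qed.

Section WeightedFrobenius.
Variables (R : realType) (n : nat) (B : 'M[R]_n).
Hypothesis B_spd : spd_mx B.

Lemma sqnormFB_gram (L X : 'M[R]_n) :
  B = L *m L^T ->
  sqnormFB B X = \tr ((L^T *m X *m L)^T *m (L^T *m X *m L)).
Proof.
move=> BE; rewrite /sqnormFB BE !trmx_mul trmxK !mulmxA [RHS]mxtrace_mulC.
by rewrite mxtrace_mulC -!mulmxA mxtrace_mulC !mulmxA.
Qed.

Lemma sqnormFB_ge0 (X : 'M[R]_n) : 0 <= sqnormFB B X.
Proof.
have [L BE] := cholesky B_spd; rewrite (sqnormFB_gram _ BE) mxtrace_gram.
by do 2!apply: sumr_ge0 => ? _; exact: sqr_ge0.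
Qed.

Lemma sqnormFB_eq0 (X : 'M[R]_n) : sqnormFB B X = 0 -> X = 0.
Proof.
have [L BE] := cholesky B_spd; rewrite (sqnormFB_gram _ BE) mxtrace_gram.
move=> sum0; have : L \in unitmx.
  by have := spd_mx_unit B_spd; rewrite BE unitmx_mul => /andP[].
(* Since [L] is invertible, it suffices that [L^T *m X *m L] vanishes; a vanishing sum of squares
   kills first each column sum, then each entry. *)
move=> L_unit; suff LXL0 : L^T *m X *m L = 0.
  have LT_unit : L^T \in unitmx by rewrite unitmx_tr.
  by rewrite -[X](mulKmx LT_unit) -[_ *m X](mulmxK L_unit) LXL0 mul0mx mulmx0.
apply/matrixP => i j; rewrite [RHS]mxE; apply/eqP; rewrite -sqrf_eq0; apply/eqP.
have ge0 k : 0 <= \sum_l (L^T *m X *m L) l k ^+ 2.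
  by apply: sumr_ge0 => ? _; exact: sqr_ge0.
apply: (psumr_eq0P (P := xpredT) (F := fun l => (L^T *m X *m L) l j ^+ 2)) => //.
  by move=> *; exact: sqr_ge0.
exact: (psumr_eq0P (fun k _ => ge0 k) sum0).
Qed.

Lemma sqnormFBD_orth (U V : 'M[R]_n) :
  \tr (U^T *m B *m V *m B) = 0 ->
  sqnormFB B (U + V) = sqnormFB B U + sqnormFB B V.
Proof.
have [Bsym _] := B_spd => UV0; have VU0 : \tr (V^T *m B *m U *m B) = 0.
  by rewrite -mxtrace_tr !trmx_mul trmxK -Bsym mxtrace_mulC !mulmxA.
rewrite /sqnormFB [(U + V)^T]linearD !(mulmxDl, mulmxDr) !mxtraceD.
by rewrite UV0 VU0 addr0 add0r.
Qed.

(** The map [h] is the identity for the first problem and the first projection for the second, where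
    [Y] need not be unique; definiteness of the norm gives uniqueness of the image only. *)
Lemma sqnormFB_argmin (T : Type) (D : set T) (h : T -> 'M[R]_n)
    (X0 : 'M[R]_n) (x1 : T) :
  D x1 ->
  (forall y, D y -> \tr ((h y - h x1)^T *m B *m (h x1 - X0) *m B) = 0) ->
  h @` argmin D (fun y => 2^-1 * sqnormFB B (h y - X0)) = [set h x1].
Proof.
move=> Dx1 orth.
have pyth y : D y -> sqnormFB B (h y - X0)
    = sqnormFB B (h y - h x1) + sqnormFB B (h x1 - X0).
  by move=> /orth/sqnormFBD_orth <-; rewrite addrA subrK.
apply/seteqP; split=> [_ [y [Dy ymin] <-]|_ ->] /=.
  have := ymin _ Dx1; rewrite ler_pM2l ?invr_gt0 ?ltr0n // (pyth y) //.
  rewrite gerDr => le0; apply/eqP; rewrite -subr_eq0; apply/eqP.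
  by apply: sqnormFB_eq0; apply/eqP; rewrite eq_le le0 sqnormFB_ge0.
exists x1 => //; split=> // y Dy; rewrite ler_pM2l ?invr_gt0 ?ltr0n //.
by rewrite (pyth y) // lerDr sqnormFB_ge0.
Qed.

End WeightedFrobenius.

Section Problems.
Variables (R : realType) (n : nat) (A B Xk : 'M[R]_n).
Hypotheses (A_unit : A \in unitmx) (A_sym : symmetric_mx A).
Hypotheses (Xk_sym : symmetric_mx Xk) (B_spd : spd_mx B).

Let step q (S Y : 'M[R]_(n, q)) : 'M[R]_n :=
  2^-1 *: (Y *m S^T *m A *m invmx B + invmx B *m A^T *m S *m Y^T).

Let invmxB_sym : (invmx B)^T = invmx B.
Proof. by have [Bsym _] := B_spd; rewrite trmx_inv -Bsym. Qed.

Let step_sym q (S Y : 'M[R]_(n, q)) : (step S Y)^T = step S Y.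
Proof.
rewrite /step linearZ /= linearD /= !trmx_mul !trmxK invmxB_sym.
by rewrite !mulmxA addrC.
Qed.

Let stepB q (S Y1 Y2 : 'M[R]_(n, q)) : step S Y1 - step S Y2 = step S (Y1 - Y2).
Proof.
rewrite /step -scalerBr [(Y1 - Y2)^T]linearB !(mulmxBl, mulmxBr) opprD.
by rewrite addrACA.
Qed.

(** Each [B] next to [invmx B] cancels, possibly after a cyclic shift of the trace. One summand then
    contains [S^T *m A *m Z], the other its transpose [Z *m A^T *m S], and both are zero. *)
Let step_orth q (S Y : 'M[R]_(n, q)) (Z : 'M[R]_n) :
  Z^T = Z -> S^T *m A *m Z = 0 -> \tr ((step S Y)^T *m B *m Z *m B) = 0.
Proof.
move=> Zsym SAZ; have ZAS : Z *m A^T *m S = 0.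
  by apply: trmx_inj; rewrite !trmx_mul trmxK Zsym mulmxA SAZ trmx0.
have B_unit := spd_mx_unit B_spd.
rewrite step_sym /step -!scalemxAl mxtraceZ !mulmxDl mxtraceD.
rewrite mulmxKV // -[Y *m S^T *m A]mulmxA -[Y *m _ *m Z]mulmxA SAZ.
rewrite mulmx0 mul0mx mxtrace0 add0r mxtrace_mulC !mulmxA mulmxV // mul1mx.
by rewrite mxtrace_mulC !mulmxA ZAS !mul0mx mxtrace0 mulr0.
Qed.

Lemma problems_singleton q (S Y : 'M[R]_(n, q)) (X1 : 'M[R]_n) :
  X1 = Xk + step S Y -> S^T *m A *m X1 = S^T ->
  sketch_and_project A B Xk S = [set X1] /\
  constrain_and_approximate A B Xk S = [set X1].
Proof.
move=> X1E X1_feasible; have X1_sym : X1^T = X1.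
  by rewrite X1E linearD /= -Xk_sym step_sym.
split.
- rewrite /sketch_and_project -[LHS]image_id.
  apply: (sqnormFB_argmin B_spd (h := id)) => [|X [X_feasible X_sym]]; first by [].
  (* Here the step is [X1 - Xk], the right argument of the inner product; transposing under the
     trace moves it to the left, with [Z = X - X1]. *)
  rewrite X1E [Xk + _]addrC addrK -mxtrace_tr !trmx_mul trmxK.
  have [<- _] := B_spd; rewrite mxtrace_mulC !mulmxA.
  apply: step_orth; first by rewrite -addrC -X1E linearB /= X1_sym -X_sym.
  by rewrite -addrC -X1E mulmxBr X_feasible X1_feasible subrr.
- apply: (sqnormFB_argmin B_spd (h := fst) (x1 := (X1, Y))) => [|[X Y'] /= ->].
    exact: X1E.
  (* Here the difference of two feasible points is itself a step, and [Z = X1 - invmx A]. *)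
  rewrite X1E opprD addrACA subrr add0r stepB.
  apply: step_orth; first by rewrite -X1E linearB /= X1_sym trmx_inv -A_sym.
  by rewrite -X1E mulmxBr X1_feasible mulmxK // subrr.
Qed.

Lemma sketched_gram_unit q (S : 'M[R]_(n, q)) :
  \rank S = q -> sketched_gram A B S \in unitmx.
Proof.
move=> rkS; apply: spd_mx_unit; have B_unit := spd_mx_unit B_spd.
(* A congruence of [B] by [invmx B *m A *m S], which is injective because [S] has full column
   rank. *)
have -> : sketched_gram A B S
    = (invmx B *m A *m S)^T *m B *m (invmx B *m A *m S).
  rewrite /sketched_gram !trmx_mul invmxB_sym -A_sym !mulmxA.
  by rewrite mulmxKV.
apply: spd_mx_congr => // x; rewrite -!mulmxA.
move=> /(congr1 (mulmx B)); rewrite mulKVmx // mulmx0.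
move=> /(congr1 (mulmx (invmx A))); rewrite mulKmx // mulmx0.
move=> /(congr1 trmx); rewrite trmx_mul trmx0 => xS0.
have ST_free : row_free S^T by rewrite /row_free mxrank_tr rkS.
by apply: trmx_inj; rewrite trmx0 -[LHS](mulmxKp ST_free) xS0 mul0mx.
Qed.

Lemma explicit_update_solves q (S : 'M[R]_(n, q)) :
  sketched_gram A B S \in unitmx ->
  S^T *m A *m explicit_update A B Xk S = S^T /\
  exists Y, explicit_update A B Xk S = Xk + step S Y.
Proof.
rewrite /explicit_update; set L := invmx _ => G_unit.
have GE : S^T *m A *m invmx B *m A *m S = sketched_gram A B S by [].
have LT : L^T = L.
  by rewrite trmx_inv -GE !trmx_mul trmxK invmxB_sym -A_sym !mulmxA.
(* The residual [H] is kept opaque, known only through [HE], so that distributing products does not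
   expand it. *)
have [H HE] : exists H, H = Xk *m A *m S - S by exists (Xk *m A *m S - S).
have HT : S^T *m A *m Xk - S^T = H^T.
  by rewrite HE [RHS]linearB /= !trmx_mul -A_sym -Xk_sym !mulmxA.
have HAS : H^T *m A *m S = S^T *m A *m H.
  by rewrite -HT HE mulmxBr !mulmxBl !mulmxA.
rewrite -HE HT; split.
  (* Once the Gram matrix cancels [L], the two terms ending in [L *m S^T *m A *m invmx B] cancel by
     [HAS], leaving [S^T *m A *m Xk - H^T]. *)
  rewrite mulmxDr mulmxBr !mulmxA GE mulmxV // mul1mx mulmxBr mulmx1 !mulmxA.
  by rewrite HAS addrA subrK -HT opprB addrC subrK.
(* The term of the update quadratic in [L] is symmetric by [HAS], so [V] and [V^T] each contribute
   half of it; the factor 2 on [H *m L] offsets the [2^-1] in [step]. *)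
pose V : 'M[R]_(n, q) := invmx B *m A *m S *m L *m H^T *m A *m S *m L.
exists (V - 2 *: (H *m L)).
have VT : V^T = L *m H^T *m A *m S *m L *m S^T *m A *m invmx B.
  rewrite !trmx_mul trmxK invmxB_sym -A_sym LT -!mulmxA; congr (L *m _).
  by rewrite !mulmxA HAS.
have trY : (V - 2 *: (H *m L))^T = V^T - 2 *: (L *m H^T).
  by rewrite [LHS]linearB linearZ /= [(H *m L)^T]trmx_mul LT.
rewrite /step trY VT -A_sym !(mulmxBl, mulmxBr) -!(scalemxAl, scalemxAr).
rewrite /V !mulmxA mulmx1 -addrA; congr (Xk + _).
set U := H *m L *m _ *m _ *m _; set T := _ *m L *m S^T *m A *m invmx B.
rewrite addrACA -opprD -scalerDr -mulr2n -scaler_nat -scalerBr scalerA.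
by rewrite mulVf ?pnatr_eq0 // scale1r opprD addrCA.
Qed.

Lemma problems_solvable q (S : 'M[R]_(n, q)) :
  exists X1, sketch_and_project A B Xk S = [set X1] /\
             constrain_and_approximate A B Xk S = [set X1].
Proof.
have [r [S' [Q [-> rkS' Q_free]]]] : exists r (S' : 'M_(n, r)) (Q : 'M_(r, q)),
    [/\ S = S' *m Q, \rank S' = r & row_free Q].
  exists (\rank S), (col_base S), (row_base S).
  split; [by rewrite mulmx_base | | exact: row_base_free].
  by apply/eqP; exact: col_base_full.
have G_unit := sketched_gram_unit rkS'.
have [X1_feasible [Y' X1E]] := explicit_update_solves G_unit.
exists (explicit_update A B Xk S').
have stepM Y : step (S' *m Q) Y = step S' (Y *m Q^T).
  by rewrite /step !trmx_mul trmxK !mulmxA.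
(* As [Q] has full row rank, [Q *m pinvmx Q = 1%:M], so this [Y] satisfies [Y *m Q^T = Y'] and
   yields the same step as [Y'] does for [S']. *)
apply: (@problems_singleton _ _ (Y' *m (pinvmx Q)^T)).
  by rewrite stepM -mulmxA -trmx_mul mulmxVp // trmx1 mulmx1.
by rewrite trmx_mul -!mulmxA [S'^T *m _]mulmxA X1_feasible.
Qed.

End Problems.

Theorem theorem34 (R : realType) (n q : nat) (A B Xk : 'M[R]_n)
    (S : 'M[R]_(n, q))
    (A_unit : A \in unitmx) (A_sym : symmetric_mx A)
    (Xk_sym : symmetric_mx Xk) (B_spd : spd_mx B) :
  (exists X1 : 'M[R]_n,
      sketch_and_project A B Xk S = [set X1]
      /\ constrain_and_approximate A B Xk S = [set X1])
  /\ (\rank S = q ->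
      [/\ sketched_gram A B S \in unitmx,
          sketch_and_project A B Xk S = [set explicit_update A B Xk S]
        & constrain_and_approximate A B Xk S
          = [set explicit_update A B Xk S]]).
Proof.
split=> [|rkS]; first exact: problems_solvable.
have G_unit := sketched_gram_unit A_unit A_sym B_spd rkS.
have [X1_feasible [Y X1E]] := explicit_update_solves A_sym Xk_sym B_spd G_unit.
by have [] := problems_singleton A_unit A_sym Xk_sym B_spd X1E X1_feasible.
Qed.
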